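(* Let $m \equiv 3 \pmod 4$ and $n \equiv 1 \pmod 4$ be two distinct square-free positive integers, and let $K = \mathbb{Q}(\sqrt{-m},\sqrt{n})$. If $s(\mathcal{O}_K) = 2$, then $g(\mathcal{O}_K) = 3$.
   Context: For a number field $K$, $\mathcal{O}_K$ denotes its ring of integers. $s(\mathcal{O}_K)$ is the minimal number of squares required to represent $-1$ in $\mathcal{O}_K$, i.e. the smallest positive integer $s$ such that $-1$ is a sum of $s$ squares of elements of $\mathcal{O}_K$. $g(\mathcal{O}_K)$ is the smallest positive integer $t$ such that every element of $\mathcal{O}_K$ is a sum of $t$ squares of elements of $\mathcal{O}_K$ (zero summands allowed). *)

(* Defs.v *)
From HB Require Import structures.
From mathcomp Require Import all_boot all_order all_algebra all_field.

Set Implicit Arguments.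
Unset Strict Implicit.
Unset Printing Implicit Defensive.

Import GRing.Theory.
Local Open Scope ring_scope.

(* This is false at n = 0: every d divides 0 through its square. *)
Definition square_free (n : nat) : Prop :=
  forall d : nat, (d ^ 2 %| n)%N -> d = 1%N.

(* A number field is a [fieldExtType rat]: mathcomp's field extensions are
   finite-dimensional by construction. *)
Definition in_ring_of_integers (K : fieldExtType rat) (x : K) : Prop :=
  integralOver (intr : int -> K) x.

Definition sum_of_integral_squares
    (K : fieldExtType rat) (t : nat) (x : K) : Prop :=
  exists u : 'I_t -> K,
    (forall i, in_ring_of_integers (u i)) /\ x = \sum_(i < t) u i ^+ 2.

Definition smallest_positive (P : nat -> Prop) (t : nat) : Prop :=
  [/\ (0 < t)%N, P t & forall t' : nat, (0 < t')%N -> P t' -> (t <= t')%N].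

(* The invariants s(O_K) and g(O_K) are given as relations to their value
   because no such integer need exist; for example, s(O_K) is infinite when
   K has a real embedding. *)
Definition s_integers (K : fieldExtType rat) (s : nat) : Prop :=
  smallest_positive (fun t => sum_of_integral_squares t (-1 : K)) s.

Definition g_integers (K : fieldExtType rat) (g : nat) : Prop :=
  smallest_positive
    (fun t => forall x : K,
       in_ring_of_integers x -> sum_of_integral_squares t x) g.

(* Main.v *)
Require Import Defs.
From HB Require Import structures.
From mathcomp Require Import all_boot all_order all_algebra all_field.
From mathcomp Require Import ring zify.

(** The idea is that [x ^ 4 = x] holds in O_K / 2 O_K. It holds modulo 2 in
    the order A = Z[(1 + sqrt(-m)) / 2, (1 + sqrt n) / 2], because both
    generators satisfy [c ^ 2 = c + k] with an integer k. If c is integral and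
    [2 c] is in A, then [(2 c) ^ (4 ^ j)] is in 2 A for large j, and it is
    congruent to [2 c] modulo 2 A, so c is in A: hence A has odd index in O_K.
    In particular squaring is bijective on O_K / 2 O_K.

    Upper bound: if [-1 = a ^ 2 + b ^ 2], then (a, b, 1) is isotropic for
    X^2 + Y^2 + Z^2, so this form is equivalent to [2 x y + y ^ 2 - z ^ 2];
    at [y = 1] it takes every value [c] with [c = (1 + z) ^ 2] modulo 2.

    Lower bound: if [1 + 2 u] is a sum of two squares, then [u = x ^ 2 + x]
    modulo 2 for some x, hence [u ^ 2 + u = x ^ 4 + x = 0] modulo 2. If this
    held for all u, it would hold for x, giving [u = 0] modulo 2 for all u,
    although 1 / 2 is not integral. *)

Set Implicit Arguments.
Unset Strict Implicit.
Unset Printing Implicit Defensive.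

Import GRing.Theory.
Local Open Scope ring_scope.

Lemma int_sqr_mod2 (k : int) : exists e : int, k ^+ 2 = k + 2 * e.
Proof.
have [q [->|->]] : exists q : int, k = 2 * q \/ k = 2 * q + 1.
- by exists (k %/ 2)%Z; lia.
- by exists (2 * q ^+ 2 - q); ring.
- by exists (2 * q ^+ 2 + q); ring.
Qed.

(** * Subrings given by [Prop]-valued predicates, the form in which integrality is stated *)

Section Subring.

Variable R : comNzRingType.
Implicit Types x y : R.

Definition subring (S : R -> Prop) : Prop :=
  [/\ S 1, forall x y, S x -> S y -> S (x - y)
         & forall x y, S x -> S y -> S (x * y)].

Variable S : R -> Prop.
Hypothesis ringS : subring S.

Lemma subring1 : S 1. Proof. by case: ringS. Qed.

Lemma subringB x y : S x -> S y -> S (x - y).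
Proof. by case: ringS => _ subS _; apply: subS. Qed.

Lemma subringM x y : S x -> S y -> S (x * y).
Proof. by case: ringS => _ _; apply. Qed.

Lemma subring0 : S 0.
Proof. by rewrite -(subrr 1); apply: subringB subring1 subring1. Qed.

Lemma subringN x : S x -> S (- x).
Proof. by move=> Sx; rewrite -sub0r; apply: subringB subring0 Sx. Qed.

Lemma subringD x y : S x -> S y -> S (x + y).
Proof. by move=> Sx Sy; rewrite -[y]opprK; apply/subringB/subringN. Qed.

Lemma subring_nat n : S n%:R.
Proof.
by elim: n => [|n IHn]; [apply: subring0 | rewrite -natr1; apply/subringD/subring1].
Qed.

Lemma subring_int (k : int) : S k%:~R.
Proof. by case: k => k; [|apply: subringN]; apply: subring_nat. Qed.

Lemma subringX x n : S x -> S (x ^+ n).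
Proof.
by move=> Sx; elim: n => [|n IHn]; [apply: subring1 | rewrite exprS; apply: subringM].
Qed.

Lemma subring_sum n (F : 'I_n -> R) : (forall i, S (F i)) -> S (\sum_i F i).
Proof. by move=> SF; apply: big_ind => //; [apply: subring0 | apply: subringD]. Qed.

End Subring.

Ltac ring_mem ringS := repeat first
  [ done | exact: (subring1 ringS) | exact: (subring_nat ringS)
  | exact: (subring_int ringS) | apply: (subringD ringS)
  | apply: (subringN ringS) | apply: (subringM ringS) | apply: (subringX ringS)].

(** * The congruence [x ^ 4 = x] modulo 2 and quadratic generators *)

Section PowFour.

Variable R : comNzRingType.
Implicit Types (S : R -> Prop) (x y : R).

(** The congruence is modulo [2 S], not modulo [2 R]: the quotient [y] has to lie in [S]. *)
Definition pow4_mod2 S : Prop :=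
  forall x, S x -> exists2 y, S y & x ^+ 4 = x + 2 * y.

Lemma pow4_mod2_iter S x j : subring S -> pow4_mod2 S -> S x ->
  exists2 y, S y & x ^+ (4 ^ j) = x + 2 * y.
Proof.
move=> ringS pow4S Sx; elim: j => [|j [y Sy IHj]].
  by exists 0; [apply: subring0 | rewrite expr1 mulr0 addr0].
have [z Sz zE] : exists2 z, S z & (x + 2 * y) ^+ 4 = x + 2 * y + 2 * z.
  by apply: pow4S; ring_mem ringS.
exists (y + z); first exact: (subringD ringS).
by rewrite expnSr exprM IHj zE; ring.
Qed.

Definition adjoin S (c x : R) : Prop := exists u v, [/\ S u, S v & x = u + v * c].

Lemma sub_adjoin S c x : subring S -> S x -> adjoin S c x.
Proof. by move=> ringS Sx; exists x, 0; split=> //; [apply: subring0 | ring]. Qed.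

Lemma adjoin_gen S c : subring S -> adjoin S c c.
Proof.
by move=> ringS; exists 0, 1; split; [apply: subring0 | apply: subring1 | ring].
Qed.

Section AdjoinRoot.

Variables (S : R -> Prop) (c : R) (k : int).
Hypotheses (ringS : subring S) (cE : c ^+ 2 = c + k%:~R).

Lemma subring_adjoin : subring (adjoin S c).
Proof.
split; first exact: (sub_adjoin c ringS (subring1 ringS)).
  move=> _ _ [u [v [Su Sv ->]]] [u' [v' [Su' Sv' ->]]].
  by exists (u - u'), (v - v'); split; [exact: subringB | exact: subringB | ring].
move=> _ _ [u [v [Su Sv ->]]] [u' [v' [Su' Sv' ->]]].
exists (u * u' + v * v' * k%:~R), (u * v' + u' * v + v * v').
split; try by ring_mem ringS.
transitivity (u * u' + (u * v' + u' * v) * c + v * v' * c ^+ 2); first by ring.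
by rewrite cE; ring.
Qed.

(** Modulo 2 the fourth power is additive, and [c ^ 4 = c ^ 2 + k ^ 2 = c + k + k = c], since
    [k ^ 2 = k] modulo 2. *)
Lemma pow4_mod2_adjoin : pow4_mod2 S -> pow4_mod2 (adjoin S c).
Proof.
move=> pow4S _ [u [v [Su Sv ->]]].
have [y Sy yE] := pow4S u Su; have [z Sz zE] := pow4S v Sv.
have [e eE] := int_sqr_mod2 k.
have ringA := subring_adjoin; have Ac := adjoin_gen c ringS.
have [Au Av Ay Az] : [/\ adjoin S c u, adjoin S c v, adjoin S c y & adjoin S c z].
  by split; apply: sub_adjoin.
have c4E : c ^+ 4 = c + 2 * (k%:~R + e%:~R + k%:~R * c).
  rewrite -[4%N]/(2 * 2)%N exprM cE.
  transitivity (c ^+ 2 + 2 * k%:~R * c + (k ^+ 2)%:~R); first by rewrite rmorphXn; ring.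
  by rewrite cE eE rmorphD rmorphM; ring.
(* [v ^ 4 * c ^ 4 = v * c + 2 * f]. The other terms of the witness below are [y], from [u ^ 4], and
   half of the mixed binomial terms of [(u + v * c) ^ 4]. *)
pose f := v * (k%:~R + e%:~R + k%:~R * c) + z * c ^+ 4.
exists (y + f + 2 * u ^+ 3 * (v * c) + 3 * u ^+ 2 * (v * c) ^+ 2
        + 2 * u * (v * c) ^+ 3).
  by rewrite /f; ring_mem ringA.
transitivity (u ^+ 4 + v ^+ 4 * c ^+ 4
  + 2 * (2 * u ^+ 3 * (v * c) + 3 * u ^+ 2 * (v * c) ^+ 2 + 2 * u * (v * c) ^+ 3)).
  by ring.
rewrite yE zE /f.
transitivity (u + 2 * y + v * c ^+ 4 + 2 * z * c ^+ 4
  + 2 * (2 * u ^+ 3 * (v * c) + 3 * u ^+ 2 * (v * c) ^+ 2 + 2 * u * (v * c) ^+ 3)).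
  by ring.
by rewrite {1}c4E; ring.
Qed.

End AdjoinRoot.

Definition int_image (x : R) : Prop := exists k : int, x = k%:~R.

Lemma subring_int_image : subring int_image.
Proof.
split; first by exists 1.
  by move=> _ _ [j ->] [k ->]; exists (j - k); rewrite rmorphB.
by move=> _ _ [j ->] [k ->]; exists (j * k); rewrite rmorphM.
Qed.

Lemma pow4_mod2_int_image : pow4_mod2 int_image.
Proof.
move=> _ [k ->].
have [e eE] := int_sqr_mod2 k.
exists (e * (k ^+ 2 + k + 1))%:~R; first by exists (e * (k ^+ 2 + k + 1)).
rewrite -rmorphXn -[2]/(2%:~R) -rmorphM -rmorphD; congr (_%:~R).
transitivity (k + (k ^+ 2 - k) * (k ^+ 2 + k + 1)); first by ring.
by rewrite {1}eE; ring.
Qed.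


(** * Integral elements with a multiple in a subring *)

Section Integral.

Variable S : R -> Prop.
Hypothesis ringS : subring S.

(** All powers of [c] share the denominator [a ^ d], with [d] the degree of an integral equation of
    [c]. For [i < d], [a ^ d * c ^ i = a ^ (d - i) * (a * c) ^ i]; higher powers reduce to lower
    ones by the monic equation, whose coefficients are integers. *)
Lemma integral_pow_bounded (a c : R) : integralOver (intr : int -> R) c ->
  S a -> S (a * c) -> exists d, forall i, S (a ^+ d * c ^+ i).
Proof.
move=> [p p_monic /rootP pc0] Sa Sac.
set q : {poly R} := map_poly _ p in pc0.
have q_monic : q \is monic by apply: (monic_map intr).
have qE i : q`_i = (p`_i)%:~R by rewrite /q (coef_map intr).
have [d size_q] : exists d, size q = d.+1.
  by exists (size q).-1; rewrite prednK // size_poly_gt0 monic_neq0.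
have cdE : c ^+ d = - \sum_(i < d) q`_i * c ^+ i.
  move: pc0; rewrite horner_coef size_q big_ord_recr /=.
  have -> : q`_d = 1 by have/monicP := q_monic; rewrite lead_coefE size_q.
  by rewrite mul1r => /eqP; rewrite addrC addr_eq0 => /eqP.
exists d => i; elim/ltn_ind: i => i IHi.
have [lt_id|le_di] := ltnP i d.
  rewrite -(subnK (ltnW lt_id)) exprD -mulrA -exprMn.
  by ring_mem ringS.
rewrite -(subnKC le_di) exprD cdE mulNr mulrN mulr_suml mulr_sumr.
apply/(subringN ringS)/(subring_sum ringS) => j.
rewrite qE -mulrA -exprD mulrCA.
by apply: (subringM ringS); [exact: subring_int | apply: IHi; have := ltn_ord j; lia].
Qed.

Lemma integral_half c : GRing.lreg (2 : R) -> pow4_mod2 S ->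
  integralOver (intr : int -> R) c -> S (2 * c) -> S c.
Proof.
move=> reg2 pow4S c_int S2c.
have [d Sd] := integral_pow_bounded c_int (subring_nat ringS 2) S2c.
have [y Sy yE] := pow4_mod2_iter d ringS pow4S S2c.
(* Since [4 ^ d > d], the factor [2 ^ (4 ^ d)] of [(2 * c) ^ (4 ^ d)] can spend [2 ^ d] on bringing
   [c ^ (4 ^ d)] into [S] and still keep one 2 to be cancelled against [2 * c + 2 * y]. *)
have [r rE] : exists r, (4 ^ d = r.+1 + d)%N.
  by exists (4 ^ d - d).-1; have := @ltn_expl 4 d isT; lia.
have -> : c = 2 ^+ r * (2 ^+ d * c ^+ (4 ^ d)) - y.
  apply: reg2; rewrite mulrBr; apply/eqP; rewrite eq_sym subr_eq -yE; apply/eqP.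
  by rewrite exprMn {2}rE exprD exprS; ring.
by ring_mem ringS.
Qed.

End Integral.

End PowFour.

(** * From an order to the full ring of integers *)

Section QuadraticOrders.

Variable K : fieldExtType rat.
Implicit Types (S : K -> Prop) (x y c : K).

Local Notation integral := (@in_ring_of_integers K).

Lemma natr_lreg n : GRing.lreg (n.+1%:R : K).
Proof.
apply/mulfI; suff /pcharf0P-> : has_pchar0 K by [].
by move=> p; rewrite pchar_lalg Num.Theory.pchar_num.
Qed.

Lemma subring_integral : subring integral.
Proof.
split; first exact: (@integral1 _ _ intr).
  by move=> x y; apply: (@integral_sub _ _ intr).
by move=> x y; apply: (@integral_mul _ _ intr).
Qed.

Lemma integral_quadratic c (k : int) : c ^+ 2 = c + k%:~R -> integral c.
Proof.
move=> cE; exists ('X^2 - ('X + k%:P)).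
  by rewrite monicE lead_coefDl ?lead_coefXn // size_polyXn size_polyN size_XaddC.
rewrite /root rmorphB rmorphXn rmorphD /= map_polyX map_polyC /=.
by rewrite !hornerE cE subrr.
Qed.

Lemma int_image_integral x : int_image x -> integral x.
Proof. by case=> k ->; exact: (subring_int subring_integral). Qed.

Lemma adjoin_integral S c : (forall x, S x -> integral x) -> integral c ->
  forall x, adjoin S c x -> integral x.
Proof.
by move=> SO Oc _ [u [v [/SO Ou /SO Ov ->]]]; ring_mem subring_integral.
Qed.

(** By [integral_half] over the integers, such a [c] would itself be an integer [k] with
    [2 * k = 1]. *)
Lemma half_not_integral c : integral c -> 2 * c <> 1.
Proof.
move=> c_int c2.
have S2c : int_image (2 * c) by rewrite c2; exists 1.
have ringZ := subring_int_image K.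
have [k cE] := integral_half ringZ (@natr_lreg 1) (@pow4_mod2_int_image K) c_int S2c.
have : (2 * k)%:~R = 1 :> rat.
  apply: (fmorph_inj (in_alg K)); rewrite rmorph_int rmorph1 rmorphM /= -cE.
  exact: c2.
by rewrite -[1]/(1%:~R) => /intr_inj; lia.
Qed.

(** For a subring [S] this is its rational span; when it is all of [K], every element has a positive
    integer multiple in [S]. *)
Definition frac_of S x : Prop := exists2 D, (0 < D)%N & S (D%:R * x).

Lemma subring_frac_of S : subring S -> subring (frac_of S).
Proof.
move=> ringS; split; first by exists 1%N => //; rewrite mulr1; ring_mem ringS.
  move=> x y [D D0 SDx] [E E0 SEy]; exists (D * E)%N; first by rewrite muln_gt0 D0.
  have -> : (D * E)%:R * (x - y) = E%:R * (D%:R * x) - D%:R * (E%:R * y).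
    by rewrite natrM; ring.
  by ring_mem ringS.
move=> x y [D D0 SDx] [E E0 SEy]; exists (D * E)%N; first by rewrite muln_gt0 D0.
have -> : (D * E)%:R * (x * y) = (D%:R * x) * (E%:R * y) by rewrite natrM; ring.
by ring_mem ringS.
Qed.

Lemma frac_of_rat S (r : rat) : subring S -> frac_of S r%:A.
Proof.
move=> ringS; exists `|denq r|%N; first by rewrite absz_gt0 denq_neq0.
have -> : `|denq r|%:R * r%:A = (numq r)%:~R :> K.
  rewrite pmulrn absz_denq -[r%:A]/(in_alg K r) -!(rmorph_int (in_alg K)).
  by rewrite -rmorphM mulrC -numqE.
exact: subring_int.
Qed.

Lemma subring_horner S (p : {poly K}) x : subring S -> (forall i, S p`_i) ->
  S x -> S p.[x].
Proof.
move=> ringS Sp Sx; rewrite horner_coef; apply: subring_sum => // i.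
by ring_mem ringS.
Qed.

(** [frac_of S] is a subring containing the rationals, [a] and [b], and every element of [K] is a
    polynomial in [b] whose coefficients are rational polynomials in [a]. *)
Lemma adjoin_seq_frac_of S (a b : K) : subring S -> S a -> S b ->
  <<1 & [:: a; b]>>%VS = fullv -> forall x, frac_of S x.
Proof.
move=> ringS Sa Sb gen x; have ringF := subring_frac_of ringS.
have SF y : S y -> frac_of S y by move=> Sy; exists 1%N => //; rewrite mul1r.
have : x \in <<<<1; a>>; b>>%VS by rewrite -!(adjoin_cons, adjoin_seq1) gen memvf.
move/Fadjoin_polyP => [p p_over ->]; apply: subring_horner => [//|i|]; last exact: SF.
move/polyOverP/(_ i)/Fadjoin_polyP: p_over => [q q_over ->].
apply: subring_horner => [//|j|]; last exact: SF.
by have /polyOverP/(_ j)/vlineP[r ->] := q_over; apply: frac_of_rat.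
Qed.

(** A denominator [D] of [c] can be halved by [integral_half] as long as it is even, so an odd one
    exists. The congruence for that odd multiple of [c] gives the one for [c], because odd integers
    are 1 modulo 2. *)
Lemma pow4_mod2_integral S : subring S -> pow4_mod2 S ->
  (forall x, S x -> integral x) -> (forall x, frac_of S x) -> pow4_mod2 integral.
Proof.
move=> ringS pow4S SO fracS c c_int; have [D D_gt0 SDc] := fracS c.
have [j Sjc] : exists j, S ((2 * j).+1%:R * c).
  elim/ltn_ind: D D_gt0 SDc => D IHD D_gt0 SDc.
  have [D_odd|D_even] := boolP (odd D).
    by exists D./2; rewrite mul2n -add1n -[1%N]/(nat_of_bool true) -D_odd odd_double_half.
  have DE : D = (2 * D./2)%N by rewrite mul2n even_halfK.
  apply: (IHD D./2); [lia | lia |].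
  apply: (integral_half ringS (@natr_lreg 1) pow4S).
    by ring_mem subring_integral.
  by rewrite mulrA -natrM -DE.
have [y Sy yE] := pow4S _ Sjc.
have [e eE] : exists e, ((2 * j).+1 ^ 4 = 2 * e + 1)%N.
  by exists (8 * j ^ 4 + 16 * j ^ 3 + 12 * j ^ 2 + 4 * j)%N; ring.
exists (j%:R * c + y - e%:R * c ^+ 4).
  by have Oy := SO _ Sy; ring_mem subring_integral.
have E : (2 * e%:R + 1) * c ^+ 4 = (2 * j%:R + 1) * c + 2 * y.
  transitivity ((2 * e + 1)%:R * c ^+ 4); first by ring.
  by rewrite -eE natrX -exprMn yE; ring.
transitivity ((2 * e%:R + 1) * c ^+ 4 - 2 * e%:R * c ^+ 4); first by ring.
by rewrite E; ring.
Qed.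

(** * Three squares suffice, two do not *)

Section Squares.

Hypothesis pow4O : pow4_mod2 integral.

Lemma three_squares a b c : integral a -> integral b -> a ^+ 2 + b ^+ 2 = -1 ->
  integral c -> sum_of_integral_squares 3 c.
Proof.
move=> Oa Ob abE Oc; have [d Od dE] := pow4O Oc.
(* As [w ^ 2 = c ^ 4 = c + 2 * d], the choice [z = w + 1] makes [c - 1 + z ^ 2] even, and [x] is its
   half: [2 * x + 1 - z ^ 2 = c]. *)
pose w := c ^+ 2; pose x := w ^+ 2 + w - d; pose z := w + 1.
have Ox : integral x.
  by rewrite /x /w; ring_mem subring_integral.
have Oz : integral z by rewrite /z /w; ring_mem subring_integral.
(* This is the vector [x (a, b, 1) + (0, 0, 1) + z (-b, a, 0)]. The first vector is isotropic and
   the last has norm -1 and is orthogonal to the other two, so the sum of squares is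
   [2 * x + 1 - z ^ 2]. *)
exists (tnth [tuple x * a - z * b; x * b + z * a; x + 1]); split.
  case=> [[|[|[|i]]] lti] //; rewrite (tnth_nth 0) /=; ring_mem subring_integral.
rewrite !big_ord_recl big_ord0 !(tnth_nth 0) /=.
transitivity ((x ^+ 2 + z ^+ 2) * (a ^+ 2 + b ^+ 2) + (x + 1) ^+ 2); last by ring.
rewrite abE.
have -> : c = w ^+ 2 - 2 * d by rewrite /w -exprM dE addrK.
by rewrite /x /z; ring.
Qed.

Lemma two_squares_insufficient :
  ~ (forall c, integral c -> sum_of_integral_squares 2 c).
Proof.
move=> two_sq.
(* Squaring is injective modulo 2: [c + 2 * d = c ^ 4 = 4 * e ^ 2]. *)
have sq_inj c e : integral c -> integral e -> c ^+ 2 = 2 * e ->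
    exists2 d, integral d & c = 2 * d.
  move=> Oc Oe cE; have [d Od dE] := pow4O Oc.
  exists (2 * e ^+ 2 - d); first by ring_mem subring_integral.
  have : c ^+ 4 = (c ^+ 2) ^+ 2 by rewrite -exprM.
  rewrite dE cE => E.
  by transitivity (c + 2 * d - 2 * d); [ring | rewrite E; ring].
have artin_schreier u : integral u ->
    exists x y, [/\ integral x, integral y & u = x ^+ 2 + x + 2 * y].
  move=> Ou; have /two_sq[f [Of fE]] : integral (1 + 2 * u).
    by ring_mem subring_integral.
  move: fE; rewrite !big_ord_recl big_ord0 addr0.
  move: (f ord0) (f (lift ord0 ord0)) (Of ord0) (Of (lift ord0 ord0)) => x y Ox Oy xyE.
  (* From [x ^ 2 + y ^ 2 = 1 + 2 * u], the square of [x + y - 1] is even, hence so is [x + y - 1].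
     Substituting [y = 1 - x + 2 * t] and dividing by 2 then gives [u]. *)
  have [] := @sq_inj (x + y - 1) (1 + u + x * y - x - y).
  - by ring_mem subring_integral.
  - by ring_mem subring_integral.
  - transitivity (x ^+ 2 + y ^+ 2 + (2 * x * y - 2 * x - 2 * y + 1)); first by ring.
    by rewrite -xyE; ring.
  move=> t Ot tE; exists x, (t + t ^+ 2 - x - x * t); split=> //.
    by ring_mem subring_integral.
  apply: (@natr_lreg 1).
  have yE : y = 1 - x + 2 * t by rewrite -tE; ring.
  transitivity (1 + 2 * u - 1); first by ring.
  by rewrite xyE yE; ring.
have sq_add u : integral u -> exists2 d, integral d & u ^+ 2 + u = 2 * d.
  move=> /artin_schreier[x [y [Ox Oy ->]]]; have [d Od dE] := pow4O Ox.
  exists (d + x ^+ 3 + x ^+ 2 + x + y + 2 * y * (x ^+ 2 + x) + 2 * y ^+ 2).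
    by ring_mem subring_integral.
  transitivity (x ^+ 4 + 2 * x ^+ 3 + 2 * x ^+ 2 + x
    + 4 * y * (x ^+ 2 + x) + 4 * y ^+ 2 + 2 * y); first by ring.
  by rewrite dE; ring.
(* At [u = 1], [1 = x ^ 2 + x + 2 * y] with [x ^ 2 + x] even would make 1 even. *)
have [x [y [Ox Oy xyE]]] := artin_schreier 1 (subring1 subring_integral).
have [d Od dE] := sq_add x Ox.
have Ody : integral (d + y) by ring_mem subring_integral.
by apply: (half_not_integral Ody); rewrite [RHS]xyE dE; ring.
Qed.

End Squares.

End QuadraticOrders.

(** The missing summands are filled with zeros. *)
Lemma sum_of_integral_squares_widen (K : fieldExtType rat) t t' (x : K) :
  (t <= t')%N -> sum_of_integral_squares t x -> sum_of_integral_squares t' x.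
Proof.
move=> le_tt' [u [Ou ->]].
exists (fun i : 'I_t' => if insub (i : nat) is Some j then u j else 0); split.
  move=> i; case: insub => [j|]; first exact: Ou.
  exact: (subring0 (subring_integral K)).
pose F i := if insub i is Some j then u j ^+ 2 else 0.
transitivity (\sum_(i < t) F i).
  by apply: eq_bigr => i _; rewrite /F valK.
rewrite (big_ord_widen t' F le_tt') big_mkcond /=; apply: eq_bigr => i _.
by rewrite /F; case: insubP => [j -> _ //|/negPf->]; rewrite expr0n.
Qed.

(** * The biquadratic field generated by square roots of [-m] and [n] *)

Theorem corollary1p1 (m n : nat) (m_gt0 : (0 < m)%N) (n_gt0 : (0 < n)%N)
    (m_neq_n : m <> n) (m_sqf : square_free m) (n_sqf : square_free n)
    (m_mod4 : m = 3 %[mod 4]) (n_mod4 : n = 1 %[mod 4])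
    (K : fieldExtType rat) (sqrt_Nm sqrt_n : K)
    (sqrt_NmE : sqrt_Nm ^+ 2 = - m%:R) (sqrt_nE : sqrt_n ^+ 2 = n%:R)
    (K_gen : <<1 & [:: sqrt_Nm; sqrt_n]>>%VS = fullv) :
  s_integers K 2 -> g_integers K 3.
Proof.
move=> [_ [f [Of fE]] _].
have nat_unit i : (i.+1%:R : K) != 0 by apply/lreg_neq0/natr_lreg.
have halfE (r : K) : r = 2 * ((1 + r) / 2) - 1 by rewrite mulrC divfK ?(nat_unit 1); ring.
have quadratic (r : K) (k : int) : r ^+ 2 = (1 + 4 * k)%:~R ->
    ((1 + r) / 2) ^+ 2 = (1 + r) / 2 + k%:~R.
  move=> rE; transitivity ((1 + 2 * r + r ^+ 2) / 4); first by field; rewrite (nat_unit 1) (nat_unit 3).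
  by rewrite rE rmorphD rmorphM /=; field; rewrite (nat_unit 1) (nat_unit 3).
set S1 := adjoin (@int_image K) ((1 + sqrt_Nm) / 2).
set S2 := adjoin S1 ((1 + sqrt_n) / 2).
have ringZ := subring_int_image K.
have [k1 c1E] : exists k : int, ((1 + sqrt_Nm) / 2) ^+ 2 = (1 + sqrt_Nm) / 2 + k%:~R.
  (* With [m = 4 * q + 3], [-m = 1 - 4 * (q + 1)]; the successor accounts for the residue 3. *)
  exists (- (m %/ 4).+1%:Z); apply: quadratic.
  have -> : 1 + 4 * - (m %/ 4).+1%:Z = - m%:Z :> int by lia.
  by rewrite sqrt_NmE rmorphN.
have [k2 c2E] : exists k : int, ((1 + sqrt_n) / 2) ^+ 2 = (1 + sqrt_n) / 2 + k%:~R.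
  exists (n %/ 4)%:Z; apply: quadratic.
  have -> : 1 + 4 * (n %/ 4)%:Z = n%:Z :> int by lia.
  by rewrite sqrt_nE.
have ringS1 : subring S1 := subring_adjoin ringZ c1E.
have ringS2 : subring S2 := subring_adjoin ringS1 c2E.
have pow4S2 : pow4_mod2 S2.
  by do 2![apply: pow4_mod2_adjoin; eauto]; apply: pow4_mod2_int_image.
have S2O : forall x, S2 x -> in_ring_of_integers x.
  apply: adjoin_integral (integral_quadratic c2E).
  by apply: adjoin_integral (integral_quadratic c1E); apply: int_image_integral.
have S2c1 : S2 ((1 + sqrt_Nm) / 2) by apply/(sub_adjoin _ ringS1)/adjoin_gen.
have S2c2 : S2 ((1 + sqrt_n) / 2) by apply: adjoin_gen.
have pow4O : pow4_mod2 (@in_ring_of_integers K).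
  apply: (pow4_mod2_integral ringS2 pow4S2 S2O).
  apply: (adjoin_seq_frac_of ringS2 _ _ K_gen).
    by rewrite (halfE sqrt_Nm); ring_mem ringS2.
  by rewrite (halfE sqrt_n); ring_mem ringS2.
split=> // [x Ox|t t_gt0 t_sq].
  move: fE; rewrite !big_ord_recl big_ord0 addr0 => fE.
  exact: (three_squares pow4O (Of _) (Of _) (esym fE) Ox).
(* If fewer than three squares sufficed, padding with zeros would make two suffice. *)
rewrite leqNgt; apply/negP => t_lt3; apply: (two_squares_insufficient pow4O) => c Oc.
exact: sum_of_integral_squares_widen (t_sq c Oc).
Qed.
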